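(* Let $A$ be an invertible symmetric complex $n\times n$ matrix, let $d\ge2$, and let $P(z)=\sum_{i=1}^k h_{\alpha_i}^d(z)$ for some $k\ge1$ and $\alpha_1,\dots,\alpha_k\in X_A(\mathbb{C}^n)$. Then $P(z)$ is $\Delta_A$-nilpotent if and only if the $k\times k$ matrix $$\Omega_P:=\left(\langle\alpha_i,\alpha_j\rangle_A\,h_{\alpha_j}^{d-2}(z)\right)_{k\times k}$$ is nilpotent.
   Context: $D_i=\partial/\partial z_i$, $\Delta_A=\sum_{i,j=1}^n a_{ij}D_iD_j$ for $A=(a_{ij})$. $\langle u,v\rangle_A:=u^\tau Av$ for $u,v\in\mathbb{C}^n$, and $X_A(\mathbb{C}^n)$ is the set of $u\in\mathbb{C}^n$ with $\langle u,u\rangle_A=0$. For $\alpha\in\mathbb{C}^n$, $h_\alpha(z):=\langle\alpha,z\rangle=\sum_{i=1}^n\alpha_iz_i$. A polynomial $P\in\mathbb{C}[z_1,\dots,z_n]$ is $\Delta_A$-nilpotent if $\Delta_A^m(P^m)=0$ for all $m\ge1$. Nilpotency of $\Omega_P$ is as a matrix over $\mathbb{C}[z_1,\dots,z_n]$. *)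

(* Defs.v *)
From mathcomp Require Export all_boot all_algebra.
From mathcomp Require Export complex mpoly reals.

Set Implicit Arguments.
Unset Strict Implicit.
Unset Printing Implicit Defensive.

Import GRing.Theory.
Local Open Scope ring_scope.

Section Defs.
Variables (K : comNzRingType) (n : nat).
Implicit Types (A : 'M[K]_n) (u v : 'cV[K]_n) (P : {mpoly K[n]}).

(* Bilinear: no complex conjugation. *)
Definition formA A u v : K := (u^T *m A *m v) 0 0.

Definition XA A : pred 'cV[K]_n := [pred u | formA A u u == 0].

Definition h u : {mpoly K[n]} := \sum_(i < n) u i 0 *: 'X_i.

Definition DeltaA A P : {mpoly K[n]} :=
  \sum_(i < n) \sum_(j < n) A i j *: mderiv i (mderiv j P).

Definition DeltaA_nilpotent A P : Prop :=
  forall m : nat, (1 <= m)%N -> iter m (DeltaA A) (P ^+ m) = 0.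

(* The subtraction d - 2 is truncated; it is meant for d >= 2. *)
Definition Omega A (k d : nat) (alpha : 'I_k -> 'cV[K]_n)
    : 'M[{mpoly K[n]}]_k :=
  \matrix_(i < k, j < k)
    (formA A (alpha i) (alpha j) *: h (alpha j) ^+ (d - 2)).

End Defs.

Definition mx_nilpotent (S : comNzRingType) (k : nat) (M : 'M[S]_k) : Prop :=
  exists m : nat, M ^+ m = 0.

(* Main.v *)
(** Proof. Let [Q] be the power series in [t] over the polynomial ring that
    solves [dQ/dt = <grad Q, grad Q>_A] with [Q(0) = P] (truncations modulo
    [t^N] are enough).  Both properties are equivalent to [Delta_A Q = 0].

    On the one hand, [M = Hess(Q) A] satisfies the Riccati equation
    [M' = 2 M^2], with [' = d/dt - 2 <grad Q, grad _>_A], so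
    [(tr M^k)' = 2k tr M^(k+1)].  As [tr M = Delta_A Q], this gives
    [Delta_A Q = 0] iff [tr (Hess(P) A)^k = 0] for all [k >= 1].  Since
    [Hess(P) A = d(d-1) E C] and [Omega_P = C E] for suitable [C] and [E],
    these traces all vanish iff [Omega_P] is nilpotent.

    On the other hand, if [Delta_A Q = 0] then
    [(j+1) d/dt Q^j = Delta_A Q^(j+1)], whence [Delta_A^m P^m = 0]; conversely
    [Delta_A^m P^m = 0] for all [m >= 1] forces, by induction on [m], that
    [Q^j/j! = sum_m t^m/m! Delta_A^m P^(j+m)/(j+m)!], so that
    [Delta_A Q = 0]. *)

Require Import Defs.
From HB Require Import structures.
From mathcomp Require Import ring zify.
Import GRing.Theory.
Local Open Scope ring_scope.
Local Open Scope complex_scope.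

Set Implicit Arguments.
Unset Strict Implicit.
Unset Printing Implicit Defensive.

(** * Nilpotency and traces of powers of a matrix *)

Lemma expr_mulmxS (R : pzSemiRingType) (m n p : nat)
    (C : 'M[R]_(m, n)) (E : 'M[R]_(n, m)) :
  (C *m E) ^+ p.+1 = C *m (E *m C) ^+ p *m E.
Proof.
elim: p => [|p IHp]; first by rewrite expr1 expr0 mulmx1.
by rewrite exprSr IHp exprSr -!mulmxE !mulmxA.
Qed.

Lemma map_mxX (R S : pzRingType) (f : {rmorphism R -> S}) (n k : nat)
    (M : 'M[R]_n) :
  map_mx f (M ^+ k) = map_mx f M ^+ k.
Proof.
by elim: k => [|k IHk]; rewrite ?map_mx1 // !exprS map_mxM IHk.
Qed.

Lemma mxtrace_expr_mulmxC (R : comPzSemiRingType) (m n p : nat)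
    (C : 'M[R]_(m, n)) (E : 'M[R]_(n, m)) :
  \tr ((C *m E) ^+ p.+1) = \tr ((E *m C) ^+ p.+1).
Proof.
by rewrite expr_mulmxS mxtrace_mulC mulmxA [in RHS]exprS -mulmxE.
Qed.

(** In the trace of the Cayley-Hamilton identity only the constant term survives. It is [n] times
    the determinant up to sign, so [n] must vanish in characteristic zero. *)
Lemma unitmx_traces0 (F : fieldType) (n : nat) (M : 'M[F]_n) :
    [pchar F] =i pred0 -> M \in unitmx ->
  (forall k, \tr (M ^+ k.+1) = 0) -> n = 0%N.
Proof.
case: n M => // n M /pcharf0P F0; rewrite unitmxE unitfE => dM trM.
have := congr1 (mxtrace (n := n.+1)) (Cayley_Hamilton M).
rewrite -[X in horner_mx M X]coefK poly_def raddf_sum /= size_char_poly.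
rewrite big_ord_recl /= raddfD /= raddf_sum /= big1 => [|i _].
  rewrite expr0 linearZ /= rmorph1 char_poly_det mxtrace0 addr0.
  rewrite linearZ /= mxtrace1 => /eqP.
  by rewrite !mulf_eq0 signr_eq0 (negPf dM) F0.
by rewrite linearZ /= rmorphXn /= horner_mx_X linearZ /= trM mulr0.
Qed.

(** Induction on the size. An invertible [M] satisfies either side only when [n] is 0. A singular
    [M] factors as [C *m E] through its rank, and both properties pass to the smaller matrix
    [E *m C]. *)
Lemma nilpotent_traces_field (F : fieldType) (n : nat) (M : 'M[F]_n) :
    [pchar F] =i pred0 ->
  mx_nilpotent M <-> (forall k, \tr (M ^+ k.+1) = 0).
Proof.
move=> F0; elim/ltn_ind: n M => n IHn M.
have [Mu|Mnu] := boolP (M \in unitmx).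
  split=> [[m Mm0] k|trM].
    have: M ^+ m \in unitmx.
      by elim: m {Mm0} => [|m IHm]; rewrite ?unitmx1 // exprS unitmx_mul Mu.
    rewrite Mm0 unitmxE unitfE.
    case: n {IHn} M {Mu Mm0} => [|n] M; last by rewrite det0 eqxx.
    by rewrite /mxtrace big_ord0.
  have n0 := unitmx_traces0 F0 Mu trM; subst n.
  by exists 1%N; apply: thinmx0.
have ltrn : (\rank M < n)%N.
  by rewrite ltn_neqAle rank_leq_row andbT; apply: contra Mnu;
    rewrite -row_free_unit.
have := mulmx_base M; move: (col_base M) (row_base M) => C E defM.
have IH := IHn _ ltrn (E *m C); rewrite -defM.
split=> [[m Mm0] k|trM].
  rewrite mxtrace_expr_mulmxC; apply IH; exists m.+1.
  by rewrite expr_mulmxS Mm0 mulmx0 mul0mx.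
have [|m ECm0] := proj2 IH; first by move=> k; rewrite mxtrace_expr_mulmxC.
by exists m.+1; rewrite expr_mulmxS ECm0 mulmx0 mul0mx.
Qed.

Lemma nilpotent_traces (R : idomainType) (n : nat) (M : 'M[R]_n) :
    [pchar R] =i pred0 ->
  mx_nilpotent M <-> (forall k, \tr (M ^+ k.+1) = 0).
Proof.
move=> R0; pose f : {rmorphism R -> {fraction R}} := @tofrac R.
have f_inj : injective f by by move=> x y /eqP; rewrite tofrac_eq => /eqP.
have F0 : [pchar {fraction R}] =i pred0.
  apply/pcharf0P => m; rewrite -(rmorph_nat f) -[X in _ == X](rmorph0 f).
  by rewrite (inj_eq f_inj); move/pcharf0P: R0 => ->.
have := nilpotent_traces_field (map_mx f M) F0 => -[H1 H2]; split.
  case=> m Mm0 k; apply: f_inj; rewrite rmorph0 -trace_map_mx map_mxX; apply: H1.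
  by exists m; rewrite -map_mxX Mm0 map_mx0.
move=> trM; have [|m Mm0] := H2.
  by move=> k; rewrite -map_mxX trace_map_mx trM rmorph0.
exists m; apply/matrixP => i j; apply: f_inj.
by have /matrixP/(_ i j) := Mm0; rewrite -map_mxX !mxE rmorph0.
Qed.

(** * Derivations of a commutative ring, extended to matrices and traces *)

Section Derivations.
Variable T : comNzRingType.
Implicit Types (D : T -> T) (p q : T).

Definition derivation D : Prop :=
  {morph D : p q / p + q} /\ (forall p q, D (p * q) = D p * q + p * D q).

Lemma derivation0 D : derivation D -> D 0 = 0.
Proof. by case=> DD _; apply: (addrI (D 0)); rewrite -DD !addr0. Qed.

Lemma derivation1 D : derivation D -> D 1 = 0.
Proof.
by case=> _ DM; apply: (addrI (D 1)); rewrite -[in RHS](mulr1 1) DM mulr1 mul1r addr0.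
Qed.

Lemma derivationN D p : derivation D -> D (- p) = - D p.
Proof. by move=> dD; apply: (addrI (D p)); rewrite -dD.1 !subrr derivation0. Qed.

Lemma derivationMn D p m : derivation D -> D (p *+ m) = D p *+ m.
Proof.
move=> dD; elim: m => [|m IHm]; first by rewrite !mulr0n derivation0.
by rewrite !mulrS dD.1 IHm.
Qed.

Lemma derivation_sum D (I : finType) (F : I -> T) :
  derivation D -> D (\sum_i F i) = \sum_i D (F i).
Proof. by move=> dD; apply: (big_morph D dD.1 (derivation0 dD)). Qed.

Lemma derivationX D p m : derivation D -> D (p ^+ m) = p ^+ m.-1 * D p *+ m.
Proof.
move=> dD; elim: m => [|m IHm]; first by rewrite expr0 mulr0n derivation1.
rewrite exprS dD.2 IHm [in RHS]mulrS [D p * _]mulrC; congr (_ + _).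
case: m {IHm} => [|m]; first by rewrite !mulr0n mulr0.
by rewrite mulrnAr mulrA -exprS.
Qed.

Lemma derivation_mulmx D (m n r : nat) (M : 'M[T]_(m, n)) (N : 'M[T]_(n, r)) :
    derivation D ->
  map_mx D (M *m N) = map_mx D M *m N + M *m map_mx D N.
Proof.
move=> dD; apply/matrixP => i j; rewrite !mxE derivation_sum // -big_split.
by apply: eq_bigr => l _; rewrite dD.2 !mxE.
Qed.

Lemma derivation_mxtraceX D (n k : nat) (M : 'M[T]_n) : derivation D ->
  D (\tr (M ^+ k.+1)) = \tr (M ^+ k *m map_mx D M) *+ k.+1.
Proof.
move=> dD.
have -> (N : 'M_n) : D (\tr N) = \tr (map_mx D N).
  by rewrite /mxtrace derivation_sum //; apply: eq_bigr => i _; rewrite mxE.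
(* The extra left factor [M ^+ l] makes the induction on [m] go through: the product rule peels off
   one [M], which cyclicity of the trace moves into it. *)
suff trD m l : \tr (M ^+ l *m map_mx D (M ^+ m.+1)) =
    \tr (M ^+ (l + m) *m map_mx D M) *+ m.+1.
  by have := trD k 0%N; rewrite expr0 mul1mx.
elim: m l => [|m IHm] l; first by rewrite expr1 addn0.
rewrite exprS -mulmxE derivation_mulmx // mulmxDr raddfD /= mulrS; congr (_ + _).
  by rewrite mulmxA mxtrace_mulC mulmxA mulmxE -exprD addnC.
by rewrite mulmxA mulmxE -exprSr IHm addnS.
Qed.

End Derivations.

(** * Laplacian, bracket and Hessian for commuting derivations *)

Section Laplacian.
Variables (T : comNzRingType) (n : nat) (D : 'I_n -> T -> T) (a : 'M[T]_n).
Hypothesis D_der : forall i, derivation (D i).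
Hypothesis D_comm : forall i j p, D i (D j p) = D j (D i p).
Hypothesis a_sym : a^T = a.
Hypothesis D_a : forall k i j, D k (a i j) = 0.
Implicit Types p q : T.

Definition lap p := \sum_i \sum_j a i j * D i (D j p).
Definition bracket p q := \sum_i \sum_j a i j * (D i p * D j q).
Definition hess p : 'M[T]_n := \matrix_(i, j) D i (D j p).

Lemma bracketC p q : bracket p q = bracket q p.
Proof.
rewrite /bracket exchange_big; apply: eq_bigr => i _; apply: eq_bigr => j _.
by rewrite -[in LHS]a_sym mxE [D j p * _]mulrC.
Qed.

Lemma derivation_bracket q : derivation (bracket q).
Proof.
split=> p r; rewrite /bracket.
  rewrite -big_split; apply: eq_bigr => i _; rewrite -big_split.
  by apply: eq_bigr => j _; rewrite (D_der j).1 !mulrDr.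
rewrite big_distrl big_distrr -big_split; apply: eq_bigr => i _.
rewrite big_distrl big_distrr -big_split; apply: eq_bigr => j _.
by rewrite (D_der j).2 /=; ring.
Qed.

Lemma trace_hess p : \tr (hess p *m a) = lap p.
Proof.
apply: eq_bigr => i _; rewrite mxE; apply: eq_bigr => j _.
by rewrite mxE mulrC -[in LHS]a_sym mxE.
Qed.

Lemma D_bracket k p q :
  D k (bracket p q) = bracket (D k p) q + bracket p (D k q).
Proof.
rewrite /bracket derivation_sum // -big_split; apply: eq_bigr => i _.
rewrite derivation_sum // -big_split; apply: eq_bigr => j _.
by rewrite !(D_der k).2 D_a mul0r add0r !(D_comm k) mulrDr.
Qed.

(** Of the four terms of the product rule, two put both derivatives on one factor and two put one on
    each. Symmetry of the bracket pairs them; the second pair is the quadratic term of the Riccati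
    equation. *)
Lemma hess_bracket q i j :
  D i (D j (bracket q q)) =
    bracket q (D i (D j q)) *+ 2 + (hess q *m a *m hess q) i j *+ 2.
Proof.
rewrite D_bracket bracketC -mulr2n derivationMn // D_bracket mulrnDl addrC.
congr (_ + _ *+ 2); rewrite mxE /bracket exchange_big.
apply: eq_bigr => r _; rewrite !mxE big_distrl; apply: eq_bigr => p _ /=.
by rewrite !mxE !(D_comm i) mulrCA mulrA.
Qed.

Lemma lap_exp q j :
  lap (q ^+ j.+1) = q ^+ j * lap q *+ j.+1 +
    q ^+ j.-1 * bracket q q *+ (j * j.+1).
Proof.
rewrite /lap /bracket !big_distrr -!sumrMnl -big_split; apply: eq_bigr => i _.
rewrite !big_distrr -!sumrMnl -big_split; apply: eq_bigr => l _ /=.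
rewrite derivationX // derivationMn // (D_der i).2 derivationX //=.
by ring.
Qed.

Variable dt : T -> T.
Hypothesis dt_der : derivation dt.
Hypothesis dt_comm : forall i p, dt (D i p) = D i (dt p).
Hypothesis dt_a : forall i j, dt (a i j) = 0.

(* Along the flow of [dt q = bracket q q] the matrix [M = hess q *m a] solves
   the Riccati equation [M' = 2 M^2], where ['] is the derivation
   [dt - 2 bracket q]; the term with [hess (dt q - bracket q q)] is the error. *)
Lemma dt_trace_hess q k :
  dt (\tr ((hess q *m a) ^+ k.+1)) =
    bracket q (\tr ((hess q *m a) ^+ k.+1)) *+ 2 +
    \tr ((hess q *m a) ^+ k.+2) *+ (2 * k.+1) +
    \tr ((hess q *m a) ^+ k *m (hess (dt q - bracket q q) *m a)) *+ k.+1.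
Proof.
set M := hess q *m a.
pose d p := dt p - bracket q p *+ 2.
have d_der : derivation d.
  have [bD bM] := derivation_bracket q.
  split=> p r; first by rewrite /d dt_der.1 bD; ring.
  by rewrite /d dt_der.2 bM; ring.
have dM : map_mx d M = (M *m M) *+ 2 + hess (dt q - bracket q q) *m a.
  rewrite derivation_mulmx // [map_mx d a](_ : _ = 0); last first.
    apply/matrixP => i j; rewrite !mxE /d dt_a sub0r.
    rewrite /bracket big1 ?mul0rn ?oppr0 // => r _.
    by rewrite big1 // => s _; rewrite D_a !mulr0.
  rewrite mulmx0 addr0 mulmxA -mulrnAl -mulmxDl; congr (_ *m _).
  apply/matrixP => i j; rewrite [LHS]mxE [RHS]mxE mulmxnE.
  rewrite [hess _ i j]mxE [hess (_ - _) i j]mxE /d !dt_comm.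
  rewrite !(D_der _).1 !(derivationN _ (D_der _)).
  by rewrite hess_bracket -/M; ring.
have dtE p : dt p = bracket q p *+ 2 + d p by rewrite /d addrC subrK.
rewrite [LHS]dtE -[RHS]addrA; congr (_ + _).
rewrite (derivation_mxtraceX _ _ d_der) dM mulmxDr raddfD /= mulrnDl mulrnA.
congr (_ *+ _ + _).
by rewrite mulmxE mulrnAr raddfMn /= mulrA -!exprSr.
Qed.

(** Compares the product rule for [dt] with [lap_exp]: the two terms after [lap (q ^+ j.+1)] are
    errors, which drop out when [lap q] and [dt q - bracket q q] vanish. *)
Lemma dt_exp q j :
  dt (q ^+ j) *+ j.+1 = lap (q ^+ j.+1) - q ^+ j * lap q *+ j.+1 +
    q ^+ j.-1 * (dt q - bracket q q) *+ (j * j.+1).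
Proof. by rewrite lap_exp derivationX // -mulrnA; ring. Qed.

End Laplacian.

(** * The flow of [P], with truncated power series in t represented by polynomials in [T] *)

Section Flow.
Variables (K : fieldType) (n : nat) (A : 'M[K]_n).
Hypothesis K_pchar0 : [pchar K] =i pred0.
Hypothesis A_sym : A^T = A.
Local Notation S := {mpoly K[n]}.
Local Notation T := {poly S}.
Implicit Types (p q Q : T) (P : S).

Lemma mpoly_pchar0 : [pchar S] =i pred0.
Proof. by move=> p; rewrite pchar_lalg K_pchar0. Qed.

Lemma mpoly_mulrI m : (0 < m)%N -> injective (fun P : S => P *+ m).
Proof.
case: m => // m _ P1 P2 /eqP; rewrite -subr_eq0 -mulrnBl -mulr_natl mulf_eq0.
by have /pcharf0P-> := mpoly_pchar0; rewrite subr_eq0 => /eqP.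
Qed.

Lemma mpoly_mulrn0 m (P : S) : (0 < m)%N -> P *+ m = 0 -> P = 0.
Proof. by move=> m_gt0 Pm0; apply: (mpoly_mulrI m_gt0); rewrite Pm0 mul0rn. Qed.

Definition Dx (i : 'I_n) : T -> T := map_poly (mderiv i).
Definition constA : 'M[T]_n := map_mx (fun c => c%:MP%:P) A.
Local Notation lapT := (lap Dx constA).
Local Notation bracketT := (bracket Dx constA).
Local Notation hessT := (hess Dx).

Lemma coef_Dx i p m : (Dx i p)`_m = mderiv i p`_m.
Proof. exact: coef_map. Qed.

Lemma derivation_mderiv i : derivation (mderiv i : S -> S).
Proof. by split=> p q; rewrite ?mderivD ?mderivM. Qed.

Lemma derivation_Dx i : derivation (Dx i).
Proof.
split=> p q; apply/polyP => m; first by rewrite coefD !coef_Dx coefD mderivD.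
rewrite coefD coef_Dx !coefM raddf_sum -big_split; apply: eq_bigr => j _ /=.
by rewrite mderivM !coef_Dx.
Qed.

Lemma derivation_deriv : derivation (@deriv S).
Proof. by split=> p q; rewrite ?derivD ?derivM. Qed.

Lemma Dx_comm i j p : Dx i (Dx j p) = Dx j (Dx i p).
Proof. by apply/polyP => m; rewrite !coef_Dx mderiv_comm. Qed.

Lemma deriv_Dx i p : (Dx i p)^`() = Dx i p^`().
Proof.
by apply/polyP => m; rewrite coef_Dx !coef_deriv coef_Dx mderivMn.
Qed.

Lemma constA_sym : constA^T = constA.
Proof. by apply/matrixP => i j; rewrite !mxE -[in LHS]A_sym mxE. Qed.

Lemma Dx_constA k i j : Dx k (constA i j) = 0.
Proof. by rewrite mxE /Dx map_polyC /= mderivC. Qed.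

Lemma deriv_constA i j : (constA i j)^`() = 0.
Proof. by rewrite mxE derivC. Qed.

Lemma coef_lap p m : (lapT p)`_m = DeltaA A p`_m.
Proof.
rewrite /lap /DeltaA coef_sum; apply: eq_bigr => i _.
rewrite coef_sum; apply: eq_bigr => j _.
by rewrite mxE coefCM mul_mpolyC !coef_Dx.
Qed.

Lemma DeltaA_is_zmod_morphism : zmod_morphism (DeltaA A : S -> S).
Proof.
move=> P1 P2; rewrite /DeltaA -sumrB; apply: eq_bigr => i _.
by rewrite -sumrB; apply: eq_bigr => j _; rewrite !mderivB scalerBr.
Qed.
HB.instance Definition _ :=
  GRing.isZmodMorphism.Build S S (DeltaA A) DeltaA_is_zmod_morphism.

Lemma lap_is_zmod_morphism : zmod_morphism lapT.
Proof. by move=> p q; apply/polyP => m; rewrite coefB !coef_lap coefB raddfB. Qed.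
HB.instance Definition _ :=
  GRing.isZmodMorphism.Build T T lapT lap_is_zmod_morphism.

Lemma iter_raddfB (V : zmodType) (f : {additive V -> V}) m (x y : V) :
  iter m f (x - y) = iter m f x - iter m f y.
Proof. by elim: m => //= m ->; rewrite raddfB. Qed.

Lemma iter_raddfMn (V : nmodType) (f : {additive V -> V}) m (x : V) k :
  iter m f (x *+ k) = iter m f x *+ k.
Proof. by elim: m => //= m ->; rewrite raddfMn. Qed.

Lemma deriv_iter_lap m p : (iter m lapT p)^`() = iter m lapT p^`().
Proof.
elim: m => //= m <-; apply/polyP => i.
by rewrite coef_deriv !coef_lap coef_deriv raddfMn.
Qed.

(** Congruence to 0 modulo t^N. *)
Definition vanish (N : nat) p : Prop := forall i, (i < N)%N -> p`_i = 0.

Lemma vanishW m N p : (m <= N)%N -> vanish N p -> vanish m p.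
Proof. by move=> le_mN p0 i lt_im; apply/p0/leq_trans/le_mN. Qed.

Lemma vanishD N p q : vanish N p -> vanish N q -> vanish N (p + q).
Proof. by move=> p0 q0 i lt_i; rewrite coefD p0 ?q0 ?addr0. Qed.

Lemma vanishN N p : vanish N p -> vanish N (- p).
Proof. by move=> p0 i lt_i; rewrite coefN p0 ?oppr0. Qed.

Lemma vanishB_trans N p q : vanish N (p - q) -> vanish N q -> vanish N p.
Proof. by move=> pq0 q0; rewrite -(subrK q p); apply: vanishD. Qed.

Lemma vanishMn N p m : vanish N p -> vanish N (p *+ m).
Proof. by move=> p0 i lt_i; rewrite coefMn p0 ?mul0rn. Qed.

Lemma vanishMl N p q : vanish N p -> vanish N (q * p).
Proof.
move=> p0 i lt_i; rewrite coefM big1 // => j _.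
by rewrite p0 ?mulr0 // (leq_ltn_trans _ lt_i) // leq_subr.
Qed.

Lemma vanishMr N p q : vanish N p -> vanish N (p * q).
Proof. by rewrite mulrC; apply: vanishMl. Qed.

Lemma vanish_sum N (I : finType) (F : I -> T) :
  (forall i, vanish N (F i)) -> vanish N (\sum_i F i).
Proof. by move=> F0 m lt_m; rewrite coef_sum big1 // => i _; apply: F0. Qed.

Lemma vanish_Dx N i p : vanish N p -> vanish N (Dx i p).
Proof. by move=> p0 m lt_m; rewrite coef_Dx p0 ?mderiv0. Qed.

Lemma vanish_deriv N p : vanish N p -> vanish N.-1 p^`().
Proof. by move=> p0 m lt_m; rewrite coef_deriv p0 ?mul0rn //; lia. Qed.

Lemma vanish_antideriv N p : p`_0 = 0 -> vanish N p^`() -> vanish N.+1 p.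
Proof.
by move=> p00 p0 [|m] //; rewrite ltnS => /p0; rewrite coef_deriv; apply: mpoly_mulrn0.
Qed.

Lemma vanish_bracket N p q : vanish N q -> vanish N (bracketT p q).
Proof.
by move=> q0; do 2![apply: vanish_sum => ?]; do 2!apply: vanishMl; apply: vanish_Dx.
Qed.

Lemma vanish_lap N p : vanish N p -> vanish N (lapT p).
Proof.
by move=> p0; do 2![apply: vanish_sum => ?]; apply: vanishMl; do 2!apply: vanish_Dx.
Qed.

Lemma vanish_iter_lap N m p : vanish N p -> vanish N (iter m lapT p).
Proof. by move=> p0; elim: m => //= m; apply: vanish_lap. Qed.

(** The equation modulo t^N determines [Q] modulo t^(N+1), because it prescribes a derivative in t;
    hence the order [N.+1] in [Delta_flow_lap0] and [trace0_flow]. *)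
Definition flow (N : nat) P Q : Prop :=
  Q`_0 = P /\ vanish N (Q^`() - bracketT Q Q).

Lemma flow_exists N P : exists Q, flow N P Q.
Proof.
elim: N => [|N [Q [Q0 Qflow]]]; first by exists P%:P; split=> //; rewrite coefC.
set r := (Q^`() - bracketT Q Q)`_N.
(* The derivative of [X] is -r t^N, which cancels the first error coefficient; the brackets
   involving [X] only enter at order N+1. *)
pose X : T := (N.+1%:R^-1 *: - r)%:P * 'X^(N.+1).
have X0 : vanish N.+1 X by move=> i lt_i; rewrite coefCM coefXn ltn_eqF ?mulr0.
exists (Q + X); split; first by rewrite coefD X0 ?addr0.
have -> : (Q + X)^`() - bracketT (Q + X) (Q + X) =
    (Q^`() - bracketT Q Q + X^`()) - (bracketT Q X *+ 2 + bracketT X X).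
  have bD p q1 q2 : bracketT p (q1 + q2) = bracketT p q1 + bracketT p q2.
    exact: (derivation_bracket constA derivation_Dx p).1.
  have bC p q : bracketT p q = bracketT q p by exact: (bracketC Dx constA_sym).
  by rewrite derivD bD !(bC (Q + X)) !bD (bC X Q); ring.
apply: vanishD; last first.
  by apply/vanishN/vanishD; first apply: vanishMn; apply: vanish_bracket.
move=> i; rewrite ltnS leq_eqVlt coefD => /predU1P[->|lt_iN]; last first.
  by rewrite Qflow // coef_deriv X0 ?mul0rn ?addr0.
rewrite -/r coef_deriv coefCM coefXn eqxx mulr1 scalerMnl -[_^-1 *+ _]mulr_natr.
by rewrite mulVf ?scale1r ?subrr //; move/pcharf0P: K_pchar0 => ->.
Qed.

Lemma flow_lap0_Delta N P Q : flow N.+1 P Q -> vanish N.+1 (lapT Q) ->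
  iter N.+1 (DeltaA A) (P ^+ N.+1) = 0.
Proof.
move=> [Q0 Qflow] lapQ0.
have step j : vanish N.+1 ((Q ^+ j)^`() *+ j.+1 - lapT (Q ^+ j.+1)).
  rewrite (dt_exp constA derivation_Dx derivation_deriv) addrAC [_ - _ - _]addrAC.
  rewrite subrr add0r; apply: vanishD; first exact/vanishN/vanishMn/vanishMl.
  exact/vanishMn/vanishMl.
(* Each step trades one Laplacian for one derivative in t, at the cost of one order. At [m = N] one
   order is left, and the coefficient at t = 0 is the claim. *)
suff lapQ m : (m <= N)%N -> vanish (N.+1 - m) (iter m.+1 lapT (Q ^+ m.+1)).
  have := lapQ N (leqnn _) 0%N; rewrite subSn // => /(_ isT) <-.
  have coef_iter k p : (iter k lapT p)`_0 = iter k (DeltaA A) p`_0.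
    by elim: k => //= k IHk; rewrite coef_lap IHk.
  rewrite coef_iter; congr iter.
  by have := rmorphXn (coefp 0) N.+1 Q; rewrite /= Q0.
elim: m => [|m IHm] lt_mN; first by rewrite expr1.
set p := iter m.+2 lapT _.
have -> : p = (iter m.+1 lapT (Q ^+ m.+1))^`() *+ m.+2 -
    iter m.+1 lapT ((Q ^+ m.+1)^`() *+ m.+2 - lapT (Q ^+ m.+2)).
  by rewrite iter_raddfB iter_raddfMn -deriv_iter_lap -iterSr; ring.
apply: vanishD; first by rewrite subnS; apply/vanishMn/vanish_deriv/IHm/ltnW.
exact/vanishN/(vanishW (leq_subr _ _))/vanish_iter_lap/step.
Qed.

(** The expansion of Q^j/j! with denominators cleared, by strong induction on [m]: the lower
    coefficients make [lapT Q] vanish far enough for [dt_exp] to yield the next one. *)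
Lemma Delta_flow_coef N P Q :
    (forall m, iter m.+1 (DeltaA A) (P ^+ m.+1) = 0) -> flow N P Q ->
  forall m j, (m <= N)%N ->
  (Q ^+ j)`_m *+ ((j + m)`! * m`!) = iter m (DeltaA A) (P ^+ (j + m)) *+ j`!.
Proof.
move=> DeltaP [Q0 Qflow]; elim/ltn_ind => -[|m] IHm j le_mN.
  rewrite addn0 muln1 /= -Q0; congr (_ *+ _).
  exact: (rmorphXn (coefp 0) j Q).
have lapQ0 : vanish m.+1 (lapT Q).
  (* For [j = 1] the coefficient of t^i in [Q] is a multiple of Delta^i P^(i+1), which one more
     Laplacian kills by hypothesis. *)
  move=> i lt_im; have /(_ 1%N) := IHm i lt_im; rewrite expr1 mulr1n => Qi.
  have := congr1 (DeltaA A) (Qi _); rewrite raddfMn /= -coef_lap add1n -iterS DeltaP.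
  move=> /(_ (ltnW (leq_trans lt_im le_mN))).
  by apply: mpoly_mulrn0; rewrite muln_gt0 !fact_gt0.
have dQj : (Q ^+ j)`_m.+1 *+ (m.+1 * j.+1) = DeltaA A (Q ^+ j.+1)`_m.
  rewrite mulrnA -coef_deriv -coefMn -coef_lap.
  rewrite (dt_exp constA derivation_Dx derivation_deriv) -addrA coefD.
  rewrite [X in _ + X](_ : _ = 0) ?addr0 //.
  apply: (vanishD (N := m.+1)) => //; first exact/vanishN/vanishMn/vanishMl.
  exact/vanishMn/vanishMl/(vanishW le_mN).
(* The factor [j.+1], cancellable in characteristic zero, makes [dQj] applicable; the induction
   hypothesis is then used at exponent [j.+1]. *)
apply: (@mpoly_mulrI j.+1) => //=.
rewrite -mulrnA.
have -> : ((j + m.+1)`! * m.+1`! * j.+1 =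
    m.+1 * j.+1 * ((j.+1 + m)`! * m`!))%N.
  by rewrite addnS addSn (factS m); ring.
rewrite mulrnA dQj -raddfMn /= IHm // 1?ltnW // raddfMn /= addSnnS.
by rewrite -mulrnA factS mulnC.
Qed.

Lemma Delta_flow_lap0 N P Q :
    (forall m, iter m.+1 (DeltaA A) (P ^+ m.+1) = 0) -> flow N P Q ->
  vanish N.+1 (lapT Q).
Proof.
move=> DeltaP flowQ m; rewrite ltnS => le_mN.
have := congr1 (DeltaA A) (Delta_flow_coef DeltaP flowQ 1 le_mN).
rewrite expr1 mulr1n raddfMn /= -coef_lap add1n -iterS DeltaP.
by apply: mpoly_mulrn0; rewrite muln_gt0 !fact_gt0.
Qed.

(** * Traces of powers of the Hessian along the flow *)

Definition hessA P : 'M[S]_n := hess (@mderiv n K) P *m map_mx (@mpolyC n K) A.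

Local Notation trH Q k := (\tr ((hessT Q *m constA) ^+ k)).

Lemma coef_trace_hess Q k :
  (trH Q k)`_0 = \tr (hessA Q`_0 ^+ k).
Proof.
pose f : {rmorphism T -> S} := coefp 0.
have hess0 : map_mx f (hessT Q) = hess (@mderiv n K) Q`_0.
  by apply/matrixP => i j; rewrite [LHS]mxE [hessT Q i j]mxE [RHS]mxE /= !coef_Dx.
have constA0 : map_mx f constA = map_mx (@mpolyC n K) A.
  by apply/matrixP => i j; rewrite [LHS]mxE [constA i j]mxE [RHS]mxE /= coefC.
by rewrite -[LHS]/(f _) -trace_map_mx map_mxX map_mxM hess0 constA0.
Qed.

Lemma flow_trace_deriv N P Q k : flow N P Q ->
  vanish N ((trH Q k.+1)^`() - bracketT Q (trH Q k.+1) *+ 2 -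
    trH Q k.+2 *+ (2 * k.+1)).
Proof.
move=> [_ Qflow]; rewrite (dt_trace_hess derivation_Dx Dx_comm constA_sym
  Dx_constA derivation_deriv deriv_Dx deriv_constA).
set e := _ - _ in Qflow *; set t := \tr (_ *m (hess _ e *m _)).
have cancel (x y z : T) : x + y + z - x - y = z by ring.
rewrite cancel.
apply: vanishMn; apply: vanish_sum => i; rewrite mxE; apply: vanish_sum => j.
apply: vanishMl; rewrite mxE; apply: vanish_sum => l; apply: vanishMr.
by rewrite mxE; do 2!apply: vanish_Dx.
Qed.

(** All traces are treated at once, by induction on the order in t: if they vanish modulo t^m, so do
    their derivatives by the Riccati equation, and zero initial values raise the order by one. *)
Lemma trace0_flow N P Q : (forall k, \tr (hessA P ^+ k.+1) = 0) ->
  flow N P Q -> vanish N.+1 (lapT Q).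
Proof.
move=> trP flowQ; have [Q0 _] := flowQ.
suff trQ m k : (m <= N.+1)%N -> vanish m (trH Q k.+1).
  by rewrite -(trace_hess Dx constA_sym); have := trQ N.+1 0%N (leqnn _).
elim: m k => // m IHm k lt_mN.
apply: vanish_antideriv; first by rewrite coef_trace_hess Q0 trP.
have le_mN : (m <= N.+1)%N by apply: ltnW.
have du := vanishW (lt_mN : (m <= N)%N) (flow_trace_deriv k flowQ).
have t0 : vanish m (bracketT Q (trH Q k.+1) *+ 2).
  exact/vanishMn/vanish_bracket/IHm.
exact: vanishB_trans (vanishB_trans du (vanishMn _ (IHm _ le_mN))) t0.
Qed.

(** The trace equation is now solved for the higher power, starting from [lapT Q] as the first
    trace. Each differentiation in t loses one order, so exactly one remains for the power
    [N.+1]. *)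
Lemma flow_trace0 N P Q : flow N.+1 P Q -> vanish N.+1 (lapT Q) ->
  \tr (hessA P ^+ N.+1) = 0.
Proof.
move=> flowQ lapQ0; have [<- _] := flowQ; rewrite -coef_trace_hess.
suff trQ k : (k <= N)%N ->
    vanish (N.+1 - k) (trH Q k.+1).
  by apply: trQ (leqnn N) _ _; rewrite subSn // subnn.
elim: k => [_|k IHk lt_kN]; first by rewrite expr1 (trace_hess Dx constA_sym).
have IH := IHk (ltnW lt_kN).
have du := flow_trace_deriv k flowQ.
suff: vanish (N.+1 - k.+1) (trH Q k.+2 *+ (2 * k.+1)).
  by move=> u0 i lt_i; apply: (@mpoly_mulrn0 (2 * k.+1)) => //; rewrite -coefMn u0.
rewrite -[X in vanish _ X](subKr ((trH Q k.+1)^`() - bracketT Q (trH Q k.+1) *+ 2)).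
apply: vanishD; last exact/vanishN/(vanishW (leq_subr _ _) du).
apply: vanishD; first by rewrite subnS; apply: vanish_deriv.
by apply/vanishN/vanishMn/vanish_bracket/(vanishW _ IH); lia.
Qed.

Lemma Delta_powers_trace P : 
  (forall m, iter m.+1 (DeltaA A) (P ^+ m.+1) = 0) <->
  (forall k, \tr (hessA P ^+ k.+1) = 0).
Proof.
split=> [DeltaP k | trP m].
  have [Q flowQ] := flow_exists k.+1 P; apply: (flow_trace0 flowQ).
  exact: vanishW (Delta_flow_lap0 DeltaP flowQ).
have [Q flowQ] := flow_exists m.+1 P; apply: (flow_lap0_Delta flowQ).
exact: vanishW (trace0_flow trP flowQ).
Qed.

End Flow.

(** * Hessians of powers of linear forms and the matrix [Omega] *)

Lemma mderiv_h (K : comNzRingType) (n : nat) (u : 'cV[K]_n) (i : 'I_n) :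
  mderiv i (h u) = (u i 0)%:MP.
Proof.
rewrite /h raddf_sum (bigD1 i) //= big1 => [|j j_neq_i].
  rewrite mderivZ mderivX mnm1E eqxx scale1r addr0.
  have -> : (U_(i) - U_(i))%MM = 0%MM :> 'X_{1..n}.
    by apply/mnmP => l; rewrite mnmBE mnm0E subnn.
  by rewrite mpolyX0 -mul_mpolyC mulr1.
by rewrite mderivZ mderivX mnm1E (negPf j_neq_i) scale0r scaler0.
Qed.

(** For [d < 2] the factor [d * d.-1] is 0, so the truncated exponent [d - 2] does no harm. *)
Lemma mderiv2_h_exp (K : fieldType) (n d : nat) (u : 'cV[K]_n) (i j : 'I_n) :
  mderiv i (mderiv j (h u ^+ d)) =
    ((u i 0 * u j 0) *: h u ^+ (d - 2)) *+ (d * d.-1).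
Proof.
have dM := @derivation_mderiv K n.
rewrite (derivationX _ _ (dM j)) mderiv_h mulrC mderivMn mderiv_mulC.
rewrite (derivationX _ _ (dM i)) mderiv_h -mul_mpolyC mpolyCM subn2.
by rewrite mulnC mulrnA mulrnAr; congr (_ *+ _ *+ _); ring.
Qed.

Section HessianFactorization.
Variables (K : fieldType) (n : nat) (A : 'M[K]_n) (d k : nat).
Variable alpha : 'I_k -> 'cV[K]_n.
Local Notation S := {mpoly K[n]}.

Definition leftOmega : 'M[S]_(k, n) :=
  \matrix_(i, l) (((alpha i)^T *m A) 0 l)%:MP.
Definition rightOmega : 'M[S]_(n, k) :=
  \matrix_(l, j) (alpha j l 0 *: h (alpha j) ^+ (d - 2)).

Lemma Omega_mulmx : Omega A d alpha = leftOmega *m rightOmega.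
Proof.
apply/matrixP => i j; rewrite mxE /formA mxE [RHS]mxE scaler_suml.
by apply: eq_bigr => l _; rewrite [leftOmega _ _]mxE [rightOmega _ _]mxE mul_mpolyC scalerA.
Qed.

(** Each summand has the rank-one Hessian d(d-1) h^(d-2) alpha alpha^T; times [A], it is a column of
    [rightOmega] times a row of [leftOmega]. *)
Lemma hessA_sum_h_exp :
  hessA A (\sum_i h (alpha i) ^+ d) = (rightOmega *m leftOmega) *+ (d * d.-1).
Proof.
apply/matrixP => l m; rewrite mulmxnE [LHS]mxE [in RHS]mxE -sumrMnl.
transitivity (\sum_r \sum_j (alpha j l 0 * alpha j r 0 * A r m) *:
    h (alpha j) ^+ (d - 2) *+ (d * d.-1)).
  apply: eq_bigr => r _; rewrite [hess _ _ _ _]mxE [map_mx _ _ _ _]mxE.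
  rewrite !(derivation_sum _ (derivation_mderiv _ _)) mulr_suml; apply: eq_bigr => j _ /=.
  by rewrite mderiv2_h_exp mulrC mul_mpolyC -scalerMnr scalerA mulrC.
rewrite exchange_big; apply: eq_bigr => j _.
rewrite [rightOmega _ _]mxE [leftOmega _ _]mxE [X in X%:MP]mxE.
rewrite mulrC mul_mpolyC scalerA big_distrl scaler_suml -sumrMnl.
by apply: eq_bigr => r _; rewrite mxE; congr (_ *: _ *+ _) => /=; ring.
Qed.

Lemma trace_hessA_Omega m :
  \tr (hessA A (\sum_i h (alpha i) ^+ d) ^+ m.+1) =
    \tr (Omega A d alpha ^+ m.+1) *+ (d * d.-1) ^ m.+1.
Proof.
by rewrite hessA_sum_h_exp exprMn_n raddfMn /= Omega_mulmx mxtrace_expr_mulmxC.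
Qed.

End HessianFactorization.

Theorem proposition3p10 (R : realType) (n : nat) (A : 'M[R[i]]_n)
    (A_inv : A \in unitmx) (A_sym : A^T = A)
    (d : nat) (d_ge2 : (2 <= d)%N)
    (k : nat) (k_ge1 : (1 <= k)%N) (alpha : 'I_k -> 'cV[R[i]]_n)
    (alpha_iso : forall i : 'I_k, alpha i \in XA A)
    (P : {mpoly R[i][n]}) (P_def : P = \sum_(i < k) h (alpha i) ^+ d) :
  DeltaA_nilpotent A P <-> mx_nilpotent (Omega A d alpha).
Proof.
have C0 : [pchar R[i]] =i pred0 := Num.Theory.pchar_num _.
have [Delta_tr tr_Delta] := Delta_powers_trace C0 A_sym P.
have [nil_tr tr_nil] := nilpotent_traces (Omega A d alpha) (mpoly_pchar0 n C0).
split=> [DeltaP | nilOmega].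
  apply: tr_nil => m; have := Delta_tr (fun m => DeltaP m.+1 isT) m.
  rewrite P_def trace_hessA_Omega; apply: (mpoly_mulrn0 C0).
  (* The scalar relating the two traces is a power of d(d-1), positive since [d] is at least 2. *)
  by rewrite expn_gt0 muln_gt0 -subn1 subn_gt0 d_ge2 ltnW.
move=> [|m] m_gt0 //; apply: tr_Delta => l.
by rewrite P_def trace_hessA_Omega nil_tr ?mul0rn.
Qed.
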